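(* Let $\Gamma$ be a finite connected simple graph with $r+1$ vertices and $n$ edges, where $r\ge 2$, and let $F_\Gamma\in\mathbb{R}[x_1,\dots,x_n]$ be its Kirchhoff polynomial. Then $F_\Gamma$ is strictly log-concave on $(\mathbb{R}_{>0})^n$; that is, for every $\boldsymbol{a}\in(\mathbb{R}_{>0})^n$ the symmetric $n\times n$ matrix $$\left.\left(-F_\Gamma H_{F_\Gamma}+\nabla F_\Gamma(\nabla F_\Gamma)^T\right)\right|_{\boldsymbol{x}=\boldsymbol{a}}$$ is positive definite. In particular, for every $\boldsymbol{a}\in(\mathbb{R}_{>0})^n$, the matrix $H_{F_\Gamma}|_{\boldsymbol{x}=\boldsymbol{a}}$ is non-degenerate, with $n-1$ negative eigenvalues and one positive eigenvalue (counted with multiplicity), and thus $(-1)^{n-1}(\det H_{F_\Gamma})|_{\boldsymbol{x}=\boldsymbol{a}}>0$.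
   Context: For a finite connected graph $\Gamma=(V,E)$ with edges labelled $1,\dots,n$, the Kirchhoff polynomial is $F_\Gamma(x_1,\dots,x_n)=\sum_{T}\prod_{i\in T}x_i$, the sum over all spanning trees $T$ of $\Gamma$ (identified with their edge sets). For a polynomial $F$ in $n$ variables, $H_F=\left(\frac{\partial^2F}{\partial x_i\partial x_j}\right)_{1\le i,j\le n}$ is the Hessian matrix and $\nabla F$ is the gradient, here regarded as a column vector, so that $\nabla F(\nabla F)^T$ is an $n\times n$ matrix. *)

(* Defs.v *)
From mathcomp Require Import all_boot all_order all_algebra.
From mathcomp Require Import boolp reals.
From mathcomp Require Import mpoly.

Set Implicit Arguments.
Unset Strict Implicit.
Unset Printing Implicit Defensive.

Import GRing.Theory.

Record sgraph (V : finType) := SGraph {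
  adj :> rel V;
  adj_sym : ssrbool.symmetric adj;
  adj_irr : irreflexive adj
}.

Definition edges (V : finType) (G : sgraph V) : {set {set V}} :=
  [set [set p.1; p.2] | p : V * V & G p.1 p.2].

(* A labelling of the edges of G by 0, ..., n.-1: a bijection from 'I_n onto
   the edge set, so that n is the number of edges. *)
Definition edge_labelling (V : finType) (G : sgraph V) (n : nat)
    (lab : 'I_n -> {set V}) : Prop :=
  injective lab /\ lab @: [set: 'I_n] = edges G.

Definition connected (V : finType) (e : rel V) : Prop :=
  forall x y : V, connect e x y.

(* The bound 3 discards the degenerate closed walks x, y, x of a symmetric
   relation. *)
Definition acyclic (V : finType) (e : rel V) : Prop :=
  forall s : seq V, (3 <= size s)%N -> ~ ucycle e s.

Definition spanning_rel (V : finType) (n : nat) (lab : 'I_n -> {set V})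
    (T : {set 'I_n}) : rel V :=
  [rel x y | [set x; y] \in lab @: T].

(* T is the set of labels of the edges of a spanning tree: the subgraph with
   all the vertices of V and these edges is a tree. *)
Definition spanning_tree (V : finType) (n : nat) (lab : 'I_n -> {set V})
    (T : {set 'I_n}) : Prop :=
  connected (spanning_rel lab T) /\ acyclic (spanning_rel lab T).

Local Open Scope ring_scope.

Definition kirchhoff (R : realType) (V : finType) (n : nat)
    (lab : 'I_n -> {set V}) : {mpoly R[n]} :=
  \sum_(T : {set 'I_n} | `[< spanning_tree lab T >]) \prod_(i in T) 'X_i.

Definition gradient (R : realType) (n : nat) (F : {mpoly R[n]}) :
    'cV[{mpoly R[n]}]_n :=
  \col_i F^`M(i).

Definition hessian (R : realType) (n : nat) (F : {mpoly R[n]}) :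
    'M[{mpoly R[n]}]_n :=
  \matrix_(i, j) (F^`M(j))^`M(i).

Definition mx_at (R : realType) (n m p : nat) (A : 'M[{mpoly R[n]}]_(m, p))
    (a : 'I_n -> R) : 'M[R]_(m, p) :=
  map_mx (fun F : {mpoly R[n]} => F.@[a]) A.

Definition posdefmx (R : realType) (n : nat) (A : 'M[R]_n) : Prop :=
  A^T = A /\ forall v : 'cV[R]_n, v != 0 -> 0 < (v^T *m A *m v) 0 0.

Definition positive_orthant (R : realType) (n : nat) (a : 'I_n -> R) : Prop :=
  forall i, 0 < a i.

(* Where F is positive, the matrix below is F ^+ 2 times the Hessian matrix of
   - log F. *)
Definition strictly_log_concave_on (R : realType) (n : nat)
    (D : ('I_n -> R) -> Prop) (F : {mpoly R[n]}) : Prop :=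
  forall a, D a ->
    posdefmx (mx_at (- F *: hessian F + gradient F *m (gradient F)^T) a).

(* All the complex eigenvalues of A are real, and s lists them with their
   algebraic multiplicities. *)
Definition eigenvalues_with_multiplicity (R : realType) (n : nat)
    (A : 'M[R]_n) (s : seq R) : Prop :=
  char_poly A = \prod_(x <- s) ('X - x%:P).

(* Main.v *)
Require Import Defs.
From mathcomp Require Import all_boot all_order all_fingroup all_algebra.
From mathcomp Require Import boolp reals.
From mathcomp Require Import mpoly.
From mathcomp Require Import complex ring lra.
Set Implicit Arguments.
Unset Strict Implicit.
Unset Printing Implicit Defensive.
Import Order.TTheory GRing.Theory Num.Theory.
Local Open Scope ring_scope.

(** The Kirchhoff polynomial is a determinant of a matrix that depends linearly
on the variables: by the matrix-tree theorem [weighted_matrix_tree], its value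
at [a] is the determinant of the reduced Laplacian [L a] of the graph with edge
weights [a].  For positive weights [L a] is positive definite because the graph
is connected ([laplacian_posdef]), and [L v] is nonzero for every nonzero [v]
because the graph is simple, so that each weight is, up to sign, an off-diagonal
entry of the Laplacian ([laplacian_neq0]).

On the line through [a] with direction [v], the polynomial is
[p(t) = det (L a + t L v)].  A congruence that takes [L a] to the identity and
[L v] to a diagonal matrix ([simultaneous_diagonalization]) shows that
[p(t) = c (1 + d_1 t) ... (1 + d_r t)] with real [d_i], not all zero, hence
[p'(0)^2 - p(0) p''(0) = c^2 (d_1^2 + ... + d_r^2) > 0]
([det_pencil_log_gap]).  The left-hand side is the value at [v] of the quadratic
form of the matrix in the theorem ([log_concavity_form]), so strict
log-concavity follows.

For the Hessian [H] at [a], strict log-concavity says that [H] is negative on the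
nonzero vectors orthogonal to the gradient, a hyperplane.  In the direction
[v = a] one has [p(t) = F(a) (1 + t)^r], so that the quadratic form of [H] takes
the value [r (r - 1) F(a) > 0] at [a]; this is where [r >= 2] enters.  A symmetric
form that is negative on a hyperplane and positive somewhere has exactly one
positive eigenvalue, and all the others are negative ([lorentzian_signature]).

The matrix-tree theorem comes from the Cauchy-Binet formula
([cauchy_binet_diag]) applied to the incidence matrix [B] with the row of one
vertex, the root, removed.  Its maximal minors are computed over the integers.
If the edge set [T] is disconnected, the indicator function of the component of
the root gives a linear relation between the rows of the submatrix [B_T].  If
[T] is connected, paths from the root give an integral matrix [P] supported on
[T] with [B P = 1]; expanding [det (B P) = 1] by Cauchy-Binet, some [T'] inside
[T] of size [r] has a nonzero minor, and is then connected.  If [T] is minimal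
among the connected edge sets, the expansion has the single term [T' = T], so
that [T] has size [r] and its minor divides 1.  Spanning trees are exactly these
minimal connected edge sets. *)

(** * The Cauchy-Binet formula *)

(** The [r] by [r] minor on the columns in [T].  Columns are read off the list
[enum T]; the default value 0 makes this total in [T]. *)
Definition colminor (R : comNzRingType) (r n : nat) (A : 'M[R]_(r, n))
    (T : {set 'I_n}) : R :=
  \det (\matrix_(i < r, j < r) nth 0 [seq A i k | k <- enum T] j).

Lemma det_mulmx_diag_sum (R : comNzRingType) (r n : nat) (A : 'M[R]_(r, n))
    (x : 'I_n -> R) (C : 'M[R]_(n, r)) :
  \det (A *m diag_mx (\row_k x k) *m C) =
  \sum_(f : {ffun 'I_r -> 'I_n})
     (\prod_i x (f i)) * (\prod_i A i (f i)) * \det (\matrix_(i, j) C (f i) j).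
Proof.
rewrite /determinant.
under eq_bigr => s _.
  under eq_bigr => i _.
    rewrite mxE; under eq_bigr => k _ do rewrite mul_mx_diag !mxE.
    over.
  rewrite bigA_distr_bigA /= mulr_sumr; over.
rewrite exchange_big /=; apply: eq_bigr => f _.
rewrite mulr_sumr; apply: eq_bigr => s _.
rewrite !big_split /= mulrCA; congr (_ * _).
  by rewrite mulrC.
by congr (_ * _); apply: eq_bigr => i _; rewrite mxE.
Qed.

(** In the expansion [det_mulmx_diag_sum] the choices of columns that are not
injective contribute repeated rows, hence 0; the injective choices with image
[T] are the [r!] orderings of [T], and summing over these orderings recovers a
second determinant. *)
Theorem cauchy_binet_diag (R : comNzRingType) (r n : nat) (A : 'M[R]_(r, n))
    (x : 'I_n -> R) (C : 'M[R]_(n, r)) :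
  \det (A *m diag_mx (\row_k x k) *m C) =
  \sum_(T : {set 'I_n} | #|T| == r)
     (\prod_(k in T) x k) * colminor A T * colminor C^T T.
Proof.
rewrite det_mulmx_diag_sum (bigID (fun f : {ffun _} => injectiveb f)) /=.
rewrite [X in _ + X]big1 ?addr0; last first.
  move=> f /injectivePn [i1 [i2 ne12 eq12]].
  rewrite (determinant_alternate ne12) ?mulr0 // => j.
  by rewrite !mxE eq12.
rewrite (partition_big (fun f : {ffun 'I_r -> 'I_n} => f @: [set: 'I_r])
           (fun T : {set 'I_n} => #|T| == r)) /=; last first.
  by move=> f /injectiveP fI; rewrite card_imset // cardsT card_ord.
apply: eq_bigr => T /eqP cT.
pose g (j : 'I_r) := enum_val (cast_ord (esym cT) j).
have gI : injective g by move=> i j /enum_val_inj /cast_ord_inj.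
have nthg (M : 'M[R]_(r, n)) (i j : 'I_r) :
    nth 0 [seq M i k | k <- enum T] j = M i (g j).
  have j_lt : (j < size (enum T))%N by rewrite -cardE cT.
  rewrite (nth_map (g j)) //; congr (M i _).
by have := (enum_val_nth (g j) (cast_ord (esym cT) j)).
have gT : g @: [set: 'I_r] = T.
  apply/eqP; rewrite eqEcard card_imset // cardsT card_ord cT leqnn andbT.
  by apply/subsetP => _ /imsetP [j _ ->]; apply: enum_valP.
have Tg : forall k, k \in T -> exists j, g j = k.
  by move=> k; rewrite -gT => /imsetP [j _ ->]; exists j.
have detA : colminor A T = \sum_(s : 'S_r) (-1) ^+ s * \prod_i A i (g (s i)).
  rewrite /colminor /determinant; apply: eq_bigr => s _; congr (_ * _).
  by apply: eq_bigr => i _; rewrite mxE nthg.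
rewrite detA [X in _ = X * _]mulr_sumr mulr_suml.
rewrite (reindex (fun s : 'S_r => [ffun i => g (s i)])) /=; last first.
  (* Injections with image [T] factor uniquely through the enumeration [g]. *)
  pose lift_of (f : {ffun 'I_r -> 'I_n}) : 'S_r :=
    odflt 1%g [pick s : 'S_r | [forall i, g (s i) == f i]].
  exists lift_of => [s _|f /andP [/injectiveP fI /eqP fT]].
    rewrite /lift_of; case: pickP => [s' /forallP s'P|/(_ s) /forallP []] /=.
      by apply/permP => i; apply: gI; rewrite (eqP (s'P i)) ffunE.
    by move=> i; rewrite ffunE.
  have fg i : {j | g j = f i}.
    by apply/cid/Tg; rewrite -fT imset_f.
  have hI : injective (fun i => sval (fg i)).
    by move=> i j eq_ij; apply: fI; rewrite -(svalP (fg i)) eq_ij (svalP (fg j)).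
  rewrite /lift_of; case: pickP => [s /forallP sP|/(_ (perm hI)) /forallP []] /=.
    by apply/ffunP => i; rewrite ffunE (eqP (sP i)).
  by move=> i; rewrite permE (svalP (fg i)).
apply: eq_big.
  move=> s; apply/andP; split.
    by apply/injectiveP => i j; rewrite !ffunE => /gI /perm_inj.
  apply/eqP/setP => k; apply/imsetP/idP => [[j _ ->]|].
    by rewrite ffunE; apply: enum_valP.
  move=> /Tg [j <-]; exists (s^-1 j)%g; [exact: in_setT|by rewrite ffunE permKV].
move=> s _.
have -> : \prod_i x ([ffun i => g (s i)] i) = \prod_(k in T) x k.
  rewrite -gT big_imset /=; last by move=> i j _ _ /gI.
  rewrite [RHS](reindex_inj (@perm_inj _ s)) /=.
  by apply: eq_big => [i|i _]; rewrite ?in_setT ?ffunE.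
have -> : \det (\matrix_(i, j) C ([ffun i => g (s i)] i) j) =
    (-1) ^+ s * colminor C^T T.
  rewrite /colminor -det_perm -[X in _ * X]det_tr -det_mulmx; congr (\det _).
  apply/matrixP => i j; rewrite -row_permE !mxE ffunE nthg mxE.
  by rewrite /=.
have -> : \prod_i A i ([ffun i => g (s i)] i) = \prod_i A i (g (s i)).
  by apply: eq_bigr => i _; rewrite ffunE.
by rewrite -!mulrA; congr (_ * _); rewrite mulrCA.
Qed.

(** * Simultaneous diagonalization of two real quadratic forms *)

(** A left eigenvector of [A K^-1] over the complex numbers, written in real and
imaginary parts: [x + i y] is an eigenvector with eigenvalue [al + i be]. *)
Lemma complex_eigenvector_pencil (R : realType) (n : nat) (A K : 'M[R]_n) :
  (0 < n)%N -> K \in unitmx ->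
  exists x y : 'rV[R]_n, exists al be : R,
    [/\ (x != 0) || (y != 0),
        x *m A = al *: (x *m K) - be *: (y *m K)
      & y *m A = al *: (y *m K) + be *: (x *m K)].
Proof.
move=> n_gt0 Ku.
pose toC := map_mx (real_complex R).
have [z /eigenvalueP [u uz u0]] := Theorem7' (toC n n (A *m invmx K)) n_gt0.
have uA : u *m toC n n A = z *: (u *m toC n n K).
  rewrite scalemxAl -uz -mulmxA; congr (_ *m _).
  by rewrite -map_mxM mulmxKV.
have ReM (w : 'rV[R[i]]_n) (B : 'M[R]_n) :
    map_mx (@complex.Re R) (w *m toC n n B) = map_mx (@complex.Re R) w *m B.
  apply/rowP => j; rewrite !mxE raddf_sum; apply: eq_bigr => k _.
  by rewrite !mxE; case: (w 0 k) => a b; simpc.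
have ImM (w : 'rV[R[i]]_n) (B : 'M[R]_n) :
    map_mx (@complex.Im R) (w *m toC n n B) = map_mx (@complex.Im R) w *m B.
  apply/rowP => j; rewrite !mxE raddf_sum; apply: eq_bigr => k _.
  by rewrite !mxE; case: (w 0 k) => a b; simpc.
exists (map_mx (@complex.Re R) u), (map_mx (@complex.Im R) u).
exists (complex.Re z), (complex.Im z); split.
- apply: contraR u0; rewrite negb_or !negbK => /andP [/eqP x0 /eqP y0].
  apply/eqP/rowP => k; rewrite mxE.
  have := congr1 (fun M : 'rV[R]_n => M 0 k) x0.
  have := congr1 (fun M : 'rV[R]_n => M 0 k) y0.
  by rewrite !mxE; case: (u 0 k) => a b /= -> ->.
- rewrite -!ReM -!ImM uA; apply/rowP => j; rewrite !mxE.
  by case: z {uz uA} => a b; case: (\sum_ _ _) => a' b' /=.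
- rewrite -!ReM -!ImM uA; apply/rowP => j; rewrite !mxE.
  by case: z {uz uA} => a b; case: (\sum_ _ _) => a' b' /=.
Qed.

Lemma trmx_scalar (R : nzRingType) (M : 'M[R]_1) : M^T = M.
Proof. by apply/matrixP => i j; rewrite mxE !ord1. Qed.

Lemma posdefmx_unit (R : realType) (n : nat) (K : 'M[R]_n) :
  posdefmx K -> K \in unitmx.
Proof.
move=> [_ Kpos]; rewrite -row_free_unit; apply: inj_row_free => w wK.
apply/eqP; apply: contraT => w0; have := Kpos w^T.
by rewrite trmx_eq0 trmxK wK mul0mx mxE ltxx => /(_ w0).
Qed.

(** Pairing the two real equations of a complex eigenvector [x + i y] with [y] and
[x] and using the symmetry of [A] and [K], the imaginary part of the eigenvalue
times [K(x, x) + K(y, y)] vanishes.  As [K] is positive definite, the eigenvalue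
is real, and [x] or [y] is a real eigenvector. *)
Lemma real_eigenvector_pencil (R : realType) (n : nat) (A K : 'M[R]_n) :
  (0 < n)%N -> posdefmx K -> A^T = A ->
  exists v : 'cV[R]_n, exists l : R, v != 0 /\ A *m v = l *: (K *m v).
Proof.
move=> n_gt0 Kp Asym; have [Ksym Kpos] := Kp.
have [x [y [al [be [xy0 xA yA]]]]] :=
  complex_eigenvector_pencil A n_gt0 (posdefmx_unit Kp).
pose q (B : 'M[R]_n) (s t : 'rV[R]_n) : R := (s *m B *m t^T) 0 0.
have qC (B : 'M[R]_n) s t : B^T = B -> q B s t = q B t s.
  move=> Bs; rewrite /q -(trmx_scalar (s *m B *m t^T)).
  by rewrite !trmx_mul trmxK Bs mulmxA.
have q0 s : s != 0 -> 0 < q K s s.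
  by move=> s0; have := Kpos s^T; rewrite trmxK; apply; rewrite trmx_eq0.
have q_ge0 s : 0 <= q K s s.
  by have [->|/q0/ltW//] := eqVneq s 0; rewrite /q !mul0mx mxE.
have xAy : q A x y = al * q K x y - be * q K y y.
  by rewrite /q xA mulmxBl -!scalemxAl !mxE.
have yAx : q A y x = al * q K y x + be * q K x x.
  by rewrite /q yA mulmxDl -!scalemxAl !mxE.
have be0 : be = 0.
  have /eqP : be * (q K x x + q K y y) = 0.
    rewrite (qC A) // yAx (qC K) // in xAy.
    by apply/eqP; rewrite mulrDr; move: xAy; clear; lra.
  rewrite mulf_eq0 => /orP [/eqP //|]; rewrite paddr_eq0 // => /andP [x0 y0].
  by case/orP: xy0 => /q0; rewrite (eqP x0, eqP y0) ltxx.
move: xA yA; rewrite be0 !scale0r subr0 addr0 => xA yA.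
case/orP: xy0 => s0;
  [exists x^T|exists y^T]; exists al; rewrite trmx_eq0; split => //;
  by apply: trmx_inj; rewrite linearZ /= !trmx_mul trmxK Asym Ksym.
Qed.

Lemma hyperplane_basis (F : fieldType) (n : nat) (g : 'cV[F]_n.+1) :
  g != 0 -> exists2 W : 'M[F]_(n, n.+1), row_free W & W *m g = 0.
Proof.
move=> g0; have rk : \rank (kermx g) = n.
  rewrite mxrank_ker -mxrank_tr rank_rV trmx_eq0 g0 subn1 //.
have : exists2 W : 'M[F]_(\rank (kermx g), n.+1), row_free W & W *m g = 0.
  exists (row_base (kermx g)); first exact: row_base_free.
  by apply/sub_kermxP; rewrite eq_row_base.
by rewrite rk.
Qed.

(** Split off a real eigenvector [v] of the pencil, normalized for [K]: the
[K]-orthogonal complement of [v] is also [A]-orthogonal to [v], because [A v] is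
a multiple of [K v], and the induction hypothesis applies to the restrictions of
both forms to this complement.  With [K = 1] this is the spectral theorem. *)
Theorem simultaneous_diagonalization (R : realType) (n : nat) (K A : 'M[R]_n) :
  posdefmx K -> A^T = A ->
  exists U : 'M[R]_n, exists d : 'rV[R]_n,
    U^T *m K *m U = 1%:M /\ U^T *m A *m U = diag_mx d.
Proof.
elim: n K A => [|n IHn] K A Kp Asym.
  by exists 0, 0; split; apply/matrixP => -[].
have [v0 [l [v0n0 Av0]]] := real_eigenvector_pencil (ltn0Sn n) Kp Asym.
have [Ksym Kpos] := Kp.
pose c := Num.sqrt ((v0^T *m K *m v0) 0 0).
have c_gt0 : 0 < c by rewrite sqrtr_gt0 Kpos.
pose v := c^-1 *: v0.
have vKv : v^T *m K *m v = 1%:M.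
  rewrite /v [(c^-1 *: v0)^T]linearZ /= -scalemxAr -!scalemxAl.
  apply/matrixP => i j; rewrite !ord1 [LHS]mxE [X in _ * X = _]mxE [RHS]mxE eqxx.
  rewrite -[X in _ * (_ * X)]sqr_sqrtr; last exact/ltW/Kpos.
  by rewrite -/c expr2 mulKf ?gt_eqF // mulVf ?gt_eqF.
have Av : A *m v = l *: (K *m v).
  by rewrite /v -!scalemxAr Av0 !scalerA mulrC.
clearbody v.
have Kv0 : K *m v != 0.
  apply: contra_eq_neq vKv => Kv; rewrite -mulmxA Kv mulmx0.
  by rewrite eq_sym; apply/eqP => /matrixP /(_ 0 0) /eqP; rewrite !mxE oner_eq0.
have [W Wfree WKv] := hyperplane_basis Kv0.
have vKW : v^T *m K *m W^T = 0.
  by apply: trmx_inj; rewrite !trmx_mul !trmxK Ksym WKv trmx0.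
have K'p : posdefmx (W *m K *m W^T).
  split; first by rewrite !trmx_mul trmxK Ksym mulmxA.
  move=> w w0.
  have -> : w^T *m (W *m K *m W^T) *m w = (W^T *m w)^T *m K *m (W^T *m w).
    by rewrite trmx_mul trmxK !mulmxA.
  apply: Kpos; apply: contra_neq w0 => Ww; apply: trmx_inj.
  apply: (row_free_inj Wfree).
  by rewrite -[W]trmxK -!trmx_mul Ww mulmx0.
have A's : (W *m A *m W^T)^T = W *m A *m W^T.
  by rewrite !trmx_mul trmxK Asym mulmxA.
have [U' [d' [UK UA]]] := IHn _ _ K'p A's.
have blk (B : 'M[R]_n.+1) :
   (row_mx v (W^T *m U'))^T *m B *m row_mx v (W^T *m U') =
   block_mx (v^T *m (B *m v)) (v^T *m B *m W^T *m U')
            (U'^T *m (W *m (B *m v))) (U'^T *m (W *m B *m W^T) *m U').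
  by rewrite tr_row_mx mul_col_mx mul_col_row trmx_mul trmxK !mulmxA.
exists (row_mx v (W^T *m U')), (row_mx l%:M d'); split.
  rewrite blk UK vKW WKv !mul0mx mulmx0 mulmxA vKv.
  by rewrite -scalar_mx_block.
rewrite blk UA Av -!scalemxAr WKv mulmxA vKv mulmx0 scaler0.
have -> : v^T *m A = l *: (v^T *m K).
  by apply: trmx_inj; rewrite linearZ /= !trmx_mul !trmxK Asym Ksym.
rewrite -!scalemxAl vKW mul0mx scaler0 (@diag_mx_row _ n 1).
rewrite (_ : diag_mx l%:M = l *: 1%:M) //.
by apply/matrixP => i j; rewrite !mxE !ord1 eqxx mulr1.
Qed.

(** * Spanning trees and minors of the incidence matrix *)

Lemma colminor_eq0 (R : idomainType) (r n : nat) (A : 'M[R]_(r, n))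
    (T : {set 'I_n}) (v : 'rV[R]_r) :
  #|T| = r -> v != 0 -> (forall k, k \in T -> (v *m A) 0 k = 0) ->
  colminor A T = 0.
Proof.
move=> cT v0 vA; apply/eqP/det0P; exists v => //; apply/rowP => j.
have j_lt : (j < size (enum T))%N by rewrite -cardE cT.
have k0 : 'I_n by case: (enum T) j_lt => // k.
have kT : nth k0 (enum T) j \in T by rewrite -mem_enum mem_nth.
rewrite [RHS]mxE -(vA _ kT) !mxE; apply: eq_bigr => i _.
by rewrite !mxE (nth_map k0).
Qed.

Lemma colminor_intr (R : comNzRingType) (r n : nat) (A : 'M[int]_(r, n))
    (T : {set 'I_n}) :
  colminor (map_mx intr A) T = (colminor A T)%:~R :> R.
Proof.
rewrite /colminor -det_map_mx; congr (\det _); apply/matrixP => i j; rewrite !mxE.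
rewrite -[0 in LHS](rmorph0 (intmul (1 : R))).
elim: (enum T) (j : nat) => [|k s IHs] [|l] //=; by rewrite ?nth_nil ?mxE.
Qed.

Lemma set2_eq (V : finType) (u w x y : V) : x != y ->
  [set u; w] = [set x; y] -> u = x /\ w = y \/ u = y /\ w = x.
Proof.
move=> nxy e.
have xe : x \in [set u; w] by rewrite e set21.
have ye : y \in [set u; w] by rewrite e set22.
move: xe ye nxy; rewrite !in_set2.
move=> /orP [] /eqP -> /orP [] /eqP ->; rewrite ?eqxx //; by [left|right].
Qed.

(** [src] and [tgt] orient the edges; the orientation only affects signs. *)
Section Subgraphs.

Variables (V : finType) (n : nat) (lab : 'I_n -> {set V}) (src tgt : 'I_n -> V).
Hypothesis lab_inj : injective lab.
Hypothesis labE : forall k, lab k = [set src k; tgt k].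
Hypothesis src_neq_tgt : forall k, src k != tgt k.

Lemma spanning_relP (T : {set 'I_n}) (u w : V) :
  reflect (exists2 k, k \in T &
             u = src k /\ w = tgt k \/ u = tgt k /\ w = src k)
          (spanning_rel lab T u w).
Proof.
apply: (iffP imsetP) => [[k kT e]|[k kT e]]; exists k => //.
  by apply: set2_eq; rewrite ?src_neq_tgt // e labE.
by rewrite labE; case: e => -[-> ->] //; rewrite setUC.
Qed.

Lemma spanning_rel_sym (T : {set 'I_n}) : ssrbool.symmetric (spanning_rel lab T).
Proof. by move=> u w; rewrite /spanning_rel /= setUC. Qed.

Lemma spanning_rel_edge (T : {set 'I_n}) (k : 'I_n) :
  k \in T -> spanning_rel lab T (src k) (tgt k).
Proof. by move=> kT; apply/spanning_relP; exists k => //; left. Qed.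

(** Spanning trees in the form in which the minors of the incidence matrix detect
them. *)
Definition minimally_connected (T : {set 'I_n}) : Prop :=
  connected (spanning_rel lab T) /\
  forall T' : {set 'I_n},
    T' \subset T -> connected (spanning_rel lab T') -> T' = T.

(** If the ends of an edge [k] of the tree were still connected without [k], a
simple path between them, closed up by [k], would be a cycle; it has at least
three vertices because the edge [k] alone joins its ends. *)
Lemma spanning_tree_minimally_connected (T : {set 'I_n}) :
  spanning_tree lab T -> minimally_connected T.
Proof.
move=> [Tc Ta]; split=> // T' sT'T T'c; apply/eqP; rewrite eqEsubset sT'T /=.
apply/subsetP => k kT; apply: contraT => kT'.
have /connectP [p0 p0P lastp0] := T'c (src k) (tgt k).
case: (shortenP p0P) lastp0 => p pP pU _ lastp.
have eT : subrel (spanning_rel lab T') (spanning_rel lab T).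
  move=> u w /spanning_relP [l lT' e].
  by apply/spanning_relP; exists l => //; apply: (subsetP sT'T).
case: (Ta (src k :: p)); last first.
  apply/andP; split=> //; rewrite /path.cycle rcons_path (sub_path eT) //=.
  by rewrite -lastp spanning_rel_sym; apply: spanning_rel_edge.
case: p pP lastp {pU} => [|y [|z p]] //= pP lastp.
  by move: (src_neq_tgt k); rewrite lastp eqxx.
move: pP; rewrite andbT -lastp => /imsetP [l lT' ll].
by move: kT'; rewrite (lab_inj (etrans (labE k) ll)) lT'.
Qed.

(** An edge of a cycle can be removed without disconnecting the graph, since the
rest of the cycle joins its ends. *)
Lemma minimally_connected_spanning_tree (T : {set 'I_n}) :
  minimally_connected T -> spanning_tree lab T.
Proof.
move=> [Tc Tmin]; split=> // -[|x [|y [|z s]]] // _ /andP [].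
rewrite /path.cycle /= => /andP [exy /andP [eyz zs]].
rewrite !inE !negb_or => /and4P [/and3P [nxy nxz xs] /andP [nyz ys] zs' _].
have [k kT kxy] := imsetP exy.
have eD u w : u != x -> u != y -> spanning_rel lab T u w ->
    spanning_rel lab (T :\ k) u w.
  move=> ux uy /imsetP [l lT uw]; apply/imsetP; exists l => //.
  rewrite !inE lT andbT; apply: contraNneq ux => lk.
  have : u \in [set x; y] by rewrite kxy -lk -uw set21.
  by rewrite in_set2 (negPf uy) orbF.
have pD : forall s0 z0, path (spanning_rel lab T) z0 (rcons s0 x) ->
    x \notin z0 :: s0 -> y \notin z0 :: s0 ->
    connect (spanning_rel lab (T :\ k)) z0 x.
  elim=> [|w s0 IHs] z0 /= /andP [e0 p0]; rewrite !inE ?negb_or.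
    move=> nx0 ny0; apply: connect1; apply: eD => //.
      by rewrite eq_sym.
    by rewrite eq_sym.
  move=> /andP [nx0 nxs] /andP [ny0 nys].
  apply: (@connect_trans _ _ w); last by apply: IHs; rewrite // inE negb_or.
  by apply: connect1; apply: eD; rewrite // eq_sym.
have Dsym : connect_sym (spanning_rel lab (T :\ k)).
  exact/sym_connect_sym/spanning_rel_sym.
have cyx : connect (spanning_rel lab (T :\ k)) y x.
  apply: (@connect_trans _ _ z).
    apply: connect1; rewrite spanning_rel_sym; apply: eD.
    - by rewrite eq_sym.
    - by rewrite eq_sym.
    - by rewrite spanning_rel_sym.
  by apply: pD zs _ _; rewrite inE negb_or ?nxz ?nyz.
have Dc : connected (spanning_rel lab (T :\ k)).
  move=> u w; move: (Tc u w); apply: connect_sub => {}u {}w /imsetP [l lT uw].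
  have [lk|lk] := eqVneq l k; last first.
    by apply/connect1/imsetP; exists l => //; rewrite !inE lk.
  have := uw; rewrite lk -kxy => /(set2_eq nxy) [] [-> ->] //.
  by rewrite Dsym.
have := Tmin _ (subD1set T k) Dc.
by move/setP => /(_ k); rewrite !inE eqxx kT.
Qed.

(** [vtx] enumerates the vertices other than the root, which index the rows of the
reduced incidence matrix. *)
Variables (r : nat) (root : V) (vtx : 'I_r -> V).
Hypothesis vtx_inj : injective vtx.
Hypothesis vtx_neq_root : forall i, vtx i != root.
Hypothesis vtx_onto : forall x, x != root -> exists i, vtx i = x.

Definition incidence (R : nzRingType) : 'M[R]_(r, n) :=
  \matrix_(i, k) ((src k == vtx i)%:R - (tgt k == vtx i)%:R).

(** A function on all the vertices as a row vector on the vertices other than the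
root: only differences of values matter along edges, so it may be shifted to
vanish at the root. *)
Definition potential (R : nzRingType) (f : V -> R) : 'rV[R]_r :=
  \row_i (f (vtx i) - f root).

Lemma potential_incidence (R : nzRingType) (f : V -> R) :
  potential f *m incidence R = \row_k (f (src k) - f (tgt k)).
Proof.
have sumE x : \sum_i (f (vtx i) - f root) * (x == vtx i)%:R = f x - f root.
  have [->|/vtx_onto [i <-]] := eqVneq x root.
    rewrite big1 ?subrr // => i _.
    by rewrite eq_sym (negPf (vtx_neq_root i)) mulr0.
  rewrite (bigD1 i) //= eqxx mulr1 big1 ?addr0 // => j ji.
  by rewrite (inj_eq vtx_inj) eq_sym (negPf ji) mulr0.
apply/rowP => k; rewrite !mxE.
under eq_bigr => i _ do rewrite !mxE mulrBr.
by rewrite sumrB !sumE opprB addrA subrK.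
Qed.

(** On a disconnected graph some potential is constant along all edges without
being constant, and the rows of the submatrix are linearly dependent. *)
Lemma colminor_incidence_connected (R : idomainType) (T : {set 'I_n}) :
  #|T| = r -> colminor (incidence R) T != 0 -> connected (spanning_rel lab T).
Proof.
move=> cT; have Tsym := sym_connect_sym (spanning_rel_sym T).
have [rootC _ u w|] :=
    altP (@forallP _ (fun x => connect (spanning_rel lab T) root x)).
  by apply: (@connect_trans _ _ root); rewrite // Tsym.
rewrite negb_forall => /existsP [x nx] /eqP [].
(* The potential 1 on the component of the root and 0 elsewhere. *)
pose f y : R := (connect (spanning_rel lab T) root y)%:R.
apply: (@colminor_eq0 _ _ _ _ _ (potential f)) => //.
  have /vtx_onto [i vi] : x != root by apply: contraNneq nx => ->.
  apply/eqP => /rowP /(_ i); rewrite !mxE vi /f (negPf nx) connect0 sub0r.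
  by move/eqP; rewrite oppr_eq0 oner_eq0.
move=> k kT; rewrite potential_incidence mxE /f.
rewrite (same_connect_r Tsym (connect1 (spanning_rel_edge kT))) ?subrr //.
Qed.

(** The column of [P] for a vertex [x] is the signed sum of the edges of a path
from the root to [x]: its boundary is [x] minus the root, and the root has no
row.  This holds over every ring, in particular over the integers. *)
Lemma connected_incidence_right_inverse (R : nzRingType) (T : {set 'I_n}) :
  connected (spanning_rel lab T) ->
  exists2 P : 'M[R]_(n, r), incidence R *m P = 1%:M &
    forall k i, k \notin T -> P k i = 0.
Proof.
move=> Tc.
pose good x := exists2 p : 'cV[R]_n,
  incidence R *m p = \col_i (x == vtx i)%:R & forall k, k \notin T -> p k 0 = 0.
have good_root : good root.
  exists 0; last by move=> k _; rewrite mxE.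
  rewrite mulmx0; apply/colP => i; rewrite !mxE eq_sym.
  by rewrite (negPf (vtx_neq_root i)).
have incD k : incidence R *m delta_mx k 0 =
    \col_i (src k == vtx i)%:R - \col_i (tgt k == vtx i)%:R.
  by rewrite -colE; apply/colP => i; rewrite !mxE.
have good_step x y : spanning_rel lab T x y -> good x -> good y.
  move=> /spanning_relP [k kT e] [p pE pT].
  have dT l : l \notin T -> (delta_mx k 0 : 'cV[R]_n) l 0 = 0.
    move=> lT; rewrite mxE (_ : l == k = false) //.
    by apply: contraNF lT => /eqP ->.
  case: e pE => -[-> ->] pE.
    exists (p - delta_mx k 0); last first.
      by move=> l lT; rewrite mxE pT // mxE dT // subr0.
    by rewrite mulmxBr pE incD opprB addrC subrK.
  exists (p + delta_mx k 0); last first.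
    by move=> l lT; rewrite mxE pT // dT // addr0.
  by rewrite mulmxDr pE incD addrC subrK.
have good_all x : good x.
  have /connectP [q] := Tc root x; elim: q root good_root => [|y q IHq] z gz /=.
    by move=> _ ->.
  by case/andP => /good_step /(_ gz) gy; apply: IHq.
have /fin_all_exists2 [p pE pT] i := good_all (vtx i).
exists (\matrix_(k, i) p i k 0); last by move=> k i kT; rewrite mxE pT.
apply/matrixP => i j; have := congr1 (fun M : 'cV[R]_r => M i 0) (pE j).
rewrite !mxE (inj_eq vtx_inj) eq_sym => <-.
by apply: eq_bigr => k _; rewrite !mxE.
Qed.

(** Cauchy-Binet for [B D P = 1], where [D] is the diagonal matrix of the indicator
function of [T]: only the subsets of [T] contribute. *)
Lemma connected_sum_minors (T : {set 'I_n}) :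
  connected (spanning_rel lab T) ->
  exists P : 'M[int]_(n, r),
    1 = \sum_(T' : {set 'I_n} | (#|T'| == r) && (T' \subset T))
           colminor (incidence int) T' * colminor P^T T'.
Proof.
move=> /(@connected_incidence_right_inverse int) [P incP PT]; exists P.
have := cauchy_binet_diag (incidence int) (fun k => (k \in T)%:R) P.
have -> : incidence int *m diag_mx (\row_k (k \in T)%:R) *m P = 1%:M.
  rewrite -incP -mulmxA; congr (_ *m _); apply/matrixP => k i.
  rewrite mul_diag_mx !mxE.
  by case: (boolP (k \in T)) => [_|/PT ->]; rewrite ?mul1r ?mulr0.
rewrite det1 => ->; rewrite big_mkcondr; apply: eq_bigr => T' _.
case: ifP => [/subsetP sT'|/negbT /subsetPn [k kT' kT]].
  by rewrite big1 ?mul1r // => k /sT' ->.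
by rewrite (bigD1 k) //= (negPf kT) !mul0r.
Qed.

Lemma connected_sub_minor (T : {set 'I_n}) :
  connected (spanning_rel lab T) ->
  exists T' : {set 'I_n},
    [/\ T' \subset T, #|T'| = r & colminor (incidence int) T' != 0].
Proof.
move=> /connected_sum_minors [P sum1].
have [T' /and3P [sT' /eqP cT' nz]|none] := pickP (fun T' : {set 'I_n} =>
    [&& T' \subset T, #|T'| == r & colminor (incidence int) T' != 0]).
  by exists T'.
move/eqP: sum1; rewrite big1 ?oner_eq0 // => T' /andP [cT' sT'].
by have := none T'; rewrite sT' cT' /= => /negbFE/eqP ->; rewrite mul0r.
Qed.

(** Every [T'] with a nonzero term in [connected_sum_minors] is connected, so
minimality leaves the single term [T' = T]: the minor is a unit of the integers. *)
Lemma minimally_connected_minor (T : {set 'I_n}) :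
  minimally_connected T -> #|T| = r /\ colminor (incidence int) T ^+ 2 = 1.
Proof.
move=> [Tc Tmin].
have key (T' : {set 'I_n}) : T' \subset T -> #|T'| = r ->
    colminor (incidence int) T' != 0 -> T' = T.
  by move=> sT' cT' /(colminor_incidence_connected cT'); apply: Tmin.
have [T0 [sT0 cT0 nz0]] := connected_sub_minor Tc.
have cT : #|T| = r by rewrite -(key _ sT0 cT0 nz0).
split=> //; have [P] := connected_sum_minors Tc.
rewrite (bigD1 T) ?cT ?eqxx ?subxx //= big1 ?addr0; last first.
  move=> T' /andP [/andP [/eqP cT' sT'] /eqP neT].
  have [->|/(key _ sT' cT')//] := eqVneq (colminor (incidence int) T') 0.
  by rewrite mul0r.
rewrite mulrC => /esym /intUnitRing.unitzPl.
by rewrite unfold_in => /orP [] /eqP ->.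
Qed.

(** A connected subset contains a connected subset of cardinality [r], which has
to be [T] itself. *)
Lemma minor_minimally_connected (T : {set 'I_n}) :
  #|T| = r -> colminor (incidence int) T != 0 -> minimally_connected T.
Proof.
move=> cT nz; split; first exact: colminor_incidence_connected nz.
move=> T' sT' /connected_sub_minor [T0 [sT0 cT0 _]].
have eT0 : T0 = T.
  by apply/eqP; rewrite eqEcard cT cT0 leqnn andbT (subset_trans sT0).
by apply/eqP; rewrite eqEsubset sT' -{1}eT0.
Qed.

(** The reduced weighted Laplacian, factored through the incidence matrix. *)
Definition laplacian (R : realType) (a : 'I_n -> R) : 'M[R]_r :=
  incidence R *m diag_mx (\row_k a k) *m (incidence R)^T.

Lemma laplacian_form (R : realType) (a : 'I_n -> R) (f g : V -> R) :
  (potential f *m laplacian a *m (potential g)^T) 0 0 =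
  \sum_k a k * ((f (src k) - f (tgt k)) * (g (src k) - g (tgt k))).
Proof.
rewrite /laplacian !mulmxA potential_incidence -mulmxA -trmx_mul potential_incidence.
rewrite mul_mx_diag mxE; apply: eq_bigr => k _.
by rewrite !mxE mulrAC mulrA mulrC -mulrA [X in a k * X]mulrC.
Qed.

Lemma laplacianD (R : realType) (a v : 'I_n -> R) (t : R) :
  laplacian (fun k => a k + t * v k) = laplacian a + t *: laplacian v.
Proof.
rewrite /laplacian scalemxAl -mulmxDl scalemxAr -mulmxDr; congr (_ *m _ *m _).
apply/matrixP => i j; rewrite !mxE.
by case: eqP => _; rewrite ?mulr1n ?mulr0n // mulr0 addr0.
Qed.

Lemma laplacian_sym (R : realType) (a : 'I_n -> R) : (laplacian a)^T = laplacian a.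
Proof. by rewrite /laplacian !trmx_mul trmxK tr_diag_mx mulmxA. Qed.

(** The form is a sum of squares with positive weights, and vanishes only if
[w^T B = 0]; since [B] has a right inverse by connectedness, then [w = 0]. *)
Lemma laplacian_posdef (R : realType) (a : 'I_n -> R) :
  connected (spanning_rel lab [set: 'I_n]) -> positive_orthant a ->
  posdefmx (laplacian a).
Proof.
move=> /(@connected_incidence_right_inverse R) [P incP _] a_gt0.
split=> [|w w0]; first exact: laplacian_sym.
pose d := w^T *m incidence R.
have -> : (w^T *m laplacian a *m w) 0 0 = \sum_k a k * d 0 k ^+ 2.
  rewrite /laplacian !mulmxA -/d -mulmxA -[w]trmxK -trmx_mul -/d.
  rewrite mul_mx_diag mxE; apply: eq_bigr => k _.
  by rewrite !mxE mulrAC mulrC expr2.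
have d0 : d != 0.
  apply: contra_neq w0 => dE; apply: trmx_inj.
  by rewrite -[LHS]mulmx1 -incP mulmxA -/d dE mul0mx trmx0.
have /rV0Pn [k dk] := d0.
rewrite (bigD1 k) //= ltr_wpDr //.
  by apply: sumr_ge0 => l _; rewrite mulr_ge0 ?sqr_ge0 // ltW.
by rewrite mulr_gt0 // exprn_even_gt0.
Qed.

(** Evaluate the form on the indicator functions of the two ends of the edge [k]:
as no other edge has the same two ends, the result is [- a k]. *)
Lemma laplacian_neq0 (R : realType) (a : 'I_n -> R) (k : 'I_n) :
  a k != 0 -> laplacian a != 0.
Proof.
apply: contra_neq => L0.
have := laplacian_form a (fun x => (x == src k)%:R) (fun x => (x == tgt k)%:R).
rewrite L0 mulmx0 mul0mx mxE (bigD1 k) //= big1 => [|l lk].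
  rewrite !eqxx (negPf (src_neq_tgt k)) eq_sym (negPf (src_neq_tgt k)).
  rewrite sub0r subr0 mul1r mulrN1 addr0 => /esym /eqP.
  by rewrite oppr_eq0 => /eqP.
have : lab l != lab k by rewrite (inj_eq lab_inj).
rewrite !labE; have := src_neq_tgt k.
have [->|_] := eqVneq (src l) (src k).
  have [->|_] := eqVneq (tgt l) (tgt k); first by rewrite eqxx.
  by move=> /negPf ->; rewrite subrr !mulr0.
have [->|_] := eqVneq (tgt l) (src k); last by rewrite subrr mul0r mulr0.
have [->|_] := eqVneq (src l) (tgt k); first by rewrite setUC eqxx.
by move=> /negPf ->; rewrite subrr !mulr0.
Qed.

(** Cauchy-Binet writes the determinant as the sum over the edge sets [T] of
cardinality [r] of the monomial of [T] times the square of its minor, which is 1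
for spanning trees and 0 otherwise. *)
Theorem weighted_matrix_tree (R : realType) (a : 'I_n -> R) :
  (kirchhoff R lab).@[a] = \det (laplacian a).
Proof.
rewrite /kirchhoff /laplacian cauchy_binet_diag trmxK raddf_sum /=.
have incR : incidence R = map_mx intr (incidence int).
  by apply/matrixP => i k; rewrite !mxE rmorphB /= !mulrz_nat.
rewrite [LHS]big_mkcond [RHS]big_mkcond /=; apply: eq_bigr => T _.
rewrite incR colminor_intr -mulrA -expr2 -rmorphXn /=.
case: ifPn => /asboolP Ttree.
  have [-> ->] :=
    minimally_connected_minor (spanning_tree_minimally_connected Ttree).
  by rewrite eqxx mulr1 rmorph_prod /=; apply: eq_bigr => k _; rewrite mevalXU.
case: eqP => // cT; have [->|nz] := eqVneq (colminor (incidence int) T) 0.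
  by rewrite expr0n mulr0.
by case: Ttree; apply/minimally_connected_spanning_tree/minor_minimally_connected.
Qed.

End Subgraphs.

(** * Restriction of a polynomial to a line *)

Lemma horner_ext (R : numDomainType) (p q : {poly R}) :
  (forall t, p.[t] = q.[t]) -> p = q.
Proof.
move=> e; apply/eqP; rewrite -subr_eq0; apply: contraT => pq0.
pose s := [seq (i%:R : R) | i <- iota 0 (size (p - q))].
have sU : uniq s.
  by rewrite map_inj_uniq ?iota_uniq // => i j /eqP; rewrite eqr_nat => /eqP.
have sR : all (root (p - q)) s.
  by apply/allP => x _; rewrite /root hornerD hornerN e subrr.
by have := max_poly_roots pq0 sR sU; rewrite size_map size_iota ltnn.
Qed.

Section Line.

Variables (R : comNzRingType) (n : nat) (a v : 'I_n -> R).

Definition restrict_line (F : {mpoly R[n]}) : {poly R} :=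
  mmap (@polyC R) (fun i => (a i)%:P + v i *: 'X) F.

Lemma horner_restrict_line F t :
  (restrict_line F).[t] = F.@[fun i => a i + t * v i].
Proof.
rewrite /restrict_line mevalE /mmap horner_sum; apply: eq_bigr => m _.
rewrite hornerM hornerC /mmap1 horner_prod; congr (_ * _); apply: eq_bigr => i _.
by rewrite horner_exp hornerD hornerZ hornerC hornerX mulrC.
Qed.

(** The chain rule.  Both sides are derivations along the morphism
[restrict_line], so it is enough to compare them on constants and variables. *)
Lemma deriv_restrict_line F :
  (restrict_line F)^`() = \sum_i v i *: restrict_line F^`M(i).
Proof.
pose good F := (restrict_line F)^`() = \sum_i v i *: restrict_line F^`M(i).
rewrite -/(good F).
have good0 : good 0.
  rewrite /good /restrict_line raddf0 deriv0 big1 // => i _.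
  by rewrite mderiv0 raddf0 scaler0.
have goodC c : good c%:MP.
  rewrite /good /restrict_line mmapC derivC big1 // => i _.
  by rewrite mderivC raddf0 scaler0.
have goodD p q : good p -> good q -> good (p + q).
  rewrite /good /restrict_line raddfD derivD => -> ->; rewrite -big_split.
  by apply: eq_bigr => i _; rewrite mderivD raddfD scalerDr.
have goodM p q : good p -> good q -> good (p * q).
  rewrite /good /restrict_line rmorphM derivM => -> ->.
  rewrite mulr_suml mulr_sumr -big_split; apply: eq_bigr => i _.
  by rewrite mderivM rmorphD !rmorphM scalerDr -scalerAl -scalerAr.
have goodX i : good 'X_i.
  rewrite /good /restrict_line mmapX mmap1U derivD derivC add0r derivZ derivX.
  have subUU : (U_(i) - U_(i))%MM = 0%MM.
    by apply/mnmP => j; rewrite mnmBE subnn mnm0E.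
  rewrite (bigD1 i) //= mderivX mnm1E eqxx scale1r subUU mmapX mmap11.
  rewrite big1 ?addr0 // => j ji.
  by rewrite mderivX mnm1E eq_sym (negPf ji) scale0r raddf0 scaler0.
move: F; apply: (mpolyind (P := good)) => [//|].
move=> c m p _ _ goodp.
apply: goodD goodp.
rewrite -mul_mpolyC; apply: (goodM) => //; rewrite mpolyXE_id.
apply: (big_ind good) => [|p1 p2|i _]; [exact: (goodC 1)|exact: goodM|].
elim: (m i) => [|k IHk]; first exact: (goodC 1).
by rewrite exprS; apply: goodM.
Qed.

End Line.

(** Taylor coefficients at 0 of the restriction of [F] to the line through [a]
with direction [v], in terms of the gradient and the Hessian. *)
Section Quadratic.

Variables (R : realType) (n : nat) (F : {mpoly R[n]}) (a : 'I_n -> R).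

Lemma deriv1_restrict_line (v : 'cV[R]_n) :
  (restrict_line a (fun i => v i 0) F)^`().[0] =
  ((mx_at (gradient F) a)^T *m v) 0 0.
Proof.
rewrite deriv_restrict_line horner_sum mxE; apply: eq_bigr => i _.
rewrite hornerZ horner_restrict_line !mxE mulrC; congr (_ * _).
by apply: meval_eq => j; rewrite mul0r addr0.
Qed.

Lemma deriv2_restrict_line (v : 'cV[R]_n) :
  (restrict_line a (fun i => v i 0) F)^`()^`().[0] =
  (v^T *m mx_at (hessian F) a *m v) 0 0.
Proof.
rewrite deriv_restrict_line raddf_sum /= horner_sum mxE; apply: eq_bigr => j _.
rewrite derivZ deriv_restrict_line hornerZ mulrC horner_sum mxE; congr (_ * _).
apply: eq_bigr => i _.
rewrite hornerZ horner_restrict_line !mxE; congr (_ * _).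
by apply: meval_eq => k; rewrite mul0r addr0.
Qed.

Lemma horner0_restrict_line (v : 'I_n -> R) : (restrict_line a v F).[0] = F.@[a].
Proof.
by rewrite horner_restrict_line; apply: meval_eq => k; rewrite mul0r addr0.
Qed.

Lemma mx_at_log_concavity :
  mx_at (- F *: hessian F + gradient F *m (gradient F)^T) a =
  - F.@[a] *: mx_at (hessian F) a
  + mx_at (gradient F) a *m (mx_at (gradient F) a)^T.
Proof.
rewrite /mx_at map_mxD map_mxZ map_mxM map_trmx /=.
by rewrite rmorphN.
Qed.

Lemma hessian_at_sym : (mx_at (hessian F) a)^T = mx_at (hessian F) a.
Proof. by apply/matrixP => i j; rewrite !mxE mderiv_comm. Qed.

(** At 0 the right-hand side is [- p^2 (log p)'']. *)
Lemma log_concavity_form (v : 'cV[R]_n) :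
  let p := restrict_line a (fun i => v i 0) F in
  (v^T *m mx_at (- F *: hessian F + gradient F *m (gradient F)^T) a *m v) 0 0 =
  p^`().[0] ^+ 2 - p.[0] * p^`()^`().[0].
Proof.
rewrite /= mx_at_log_concavity mulmxDr mulmxDl mxE addrC.
rewrite horner0_restrict_line deriv2_restrict_line deriv1_restrict_line; congr (_ + _).
  rewrite mulmxA -mulmxA -[v^T *m _]trmxK trmx_mul trmxK.
  by rewrite mxE big_ord1 expr2 [(_^T) 0 0]mxE.
by rewrite -scalemxAr -scalemxAl mxE mulNr.
Qed.

End Quadratic.

(** * Determinants of pencils *)

(** The left-hand side is [- p^2 (log p)''] at 0, and [log p] is a sum of terms
[log (1 + x t)], each with second derivative [- x^2] at 0. *)
Lemma log_gap_prod (R : comNzRingType) (c : R) (s : seq R) :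
  let p := c *: \prod_(x <- s) (1 + x *: 'X) in
  p^`().[0] ^+ 2 - p.[0] * p^`()^`().[0] = c ^+ 2 * \sum_(x <- s) x ^+ 2.
Proof.
pose q t := \prod_(x <- t) (1 + x *: 'X) : {poly R}.
have q0 t : (q t).[0] = 1.
  rewrite /q horner_prod big1 // => x _.
  by rewrite hornerD hornerZ hornerX mulr0 addr0 hornerC.
have dX x : (1 + x *: 'X : {poly R})^`() = x%:P.
  by rewrite derivD derivC add0r derivZ derivX alg_polyC.
have key t : (q t)^`().[0] ^+ 2 - (q t)^`()^`().[0] = \sum_(x <- t) x ^+ 2.
  elim: t => [|x t IHt].
    by rewrite /q !big_nil derivC deriv0 horner0 expr0n subr0.
  rewrite big_cons -IHt /q big_cons -/(q t) derivM dX derivD !derivM derivC dX.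
  rewrite mul0r add0r !hornerE q0 /=; ring.
rewrite /= -/(q s) !derivZ !hornerZ q0 -key; ring.
Qed.

Lemma det_congruent1 (R : comNzRingType) (n : nat) (K U : 'M[R]_n) :
  U^T *m K *m U = 1%:M -> \det K * \det U ^+ 2 = 1.
Proof. by move=> UK; rewrite -(det1 R n) -UK !det_mulmx det_tr; ring. Qed.

Lemma posdefmx_det_gt0 (R : realType) (n : nat) (K : 'M[R]_n) :
  posdefmx K -> 0 < \det K.
Proof.
move=> Kp; have [U [_ [/det_congruent1 detU _]]] :=
  simultaneous_diagonalization Kp Kp.1.
rewrite ltNge; apply/negP => K0; have := ltr01 (R := R).
by rewrite -detU ltNge mulr_le0_ge0 ?sqr_ge0.
Qed.

(** After simultaneous diagonalization [p] is the product of the [1 + d_i t] up to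
the constant [det K]; the [d_i] are not all zero because [N] is nonzero. *)
Lemma det_pencil_log_gap (R : realType) (r : nat) (K N : 'M[R]_r) (p : {poly R}) :
  posdefmx K -> N^T = N -> N != 0 -> (forall t, p.[t] = \det (K + t *: N)) ->
  0 < p^`().[0] ^+ 2 - p.[0] * p^`()^`().[0].
Proof.
move=> Kp Ns N0 pE; have [U [d [UK UN]]] := simultaneous_diagonalization Kp Ns.
have detU := det_congruent1 UK.
have Uu : U \in unitmx.
  rewrite unitmxE unitfE; apply/eqP => U0; move/eqP: detU.
  by rewrite U0 expr0n mulr0 eq_sym oner_eq0.
have -> : p = \det K *: \prod_(x <- [seq d 0 i | i <- enum 'I_r]) (1 + x *: 'X).
  apply: horner_ext => t; rewrite pE hornerZ horner_prod big_map big_enum /=.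
  transitivity (\det K * \det (U^T *m (K + t *: N) *m U)).
    by rewrite !det_mulmx det_tr -[LHS]mulr1 -detU; ring.
  rewrite mulmxDr mulmxDl UK -scalemxAr -scalemxAl UN; congr (_ * _).
  rewrite -diag_const_mx -linearZ -linearD /= det_diag; apply: eq_bigr => i _.
  by rewrite !mxE !hornerE mulrC.
rewrite log_gap_prod big_map big_enum /=.
have /rV0Pn [i di] : d != 0.
  apply: contra_neq N0 => d0; move: UN; rewrite d0 linear0 => UN0.
  have UTu : U^T \in unitmx by rewrite unitmx_tr.
  by rewrite -[N](mulKmx UTu) -[_ *m N](mulmxK Uu) UN0 mul0mx mulmx0.
apply: mulr_gt0; first by rewrite exprn_gt0 // posdefmx_det_gt0.
rewrite (bigD1 i) //= ltr_wpDr ?exprn_even_gt0 //.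
by apply: sumr_ge0 => j _; apply: sqr_ge0.
Qed.

(** * Forms that are negative on a hyperplane *)

Lemma posdefmx1 (R : realType) (n : nat) : posdefmx (1%:M : 'M[R]_n).
Proof.
split=> [|v v0]; first exact: trmx1.
have /cV0Pn [i vi] := v0.
rewrite mulmx1 mxE (bigD1 i) //= ltr_wpDr //.
  by apply: sumr_ge0 => j _; rewrite mxE -expr2 sqr_ge0.
by rewrite mxE -expr2 exprn_even_gt0.
Qed.

(** In a basis of orthonormal eigenvectors, two eigenvalues that are both
nonnegative would give a plane on which the form is nonnegative; this plane meets
the hyperplane orthogonal to [g] in a nonzero vector.  Some eigenvalue is positive
because the form is positive at [w]. *)
Lemma lorentzian_signature (R : realType) (n : nat) (H : 'M[R]_n) (g w : 'cV[R]_n) :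
  H^T = H ->
  (forall v : 'cV[R]_n, v != 0 -> (g^T *m v) 0 0 = 0 ->
     (v^T *m H *m v) 0 0 < 0) ->
  0 < (w^T *m H *m w) 0 0 ->
  exists d : 'rV[R]_n,
    [/\ char_poly H = \prod_i ('X - (d 0 i)%:P),
        \det H = \prod_i d 0 i
      & exists2 i0, 0 < d 0 i0 & forall i, i != i0 -> d 0 i < 0].
Proof.
move=> Hs neg pos.
have [U [d [UU UH]]] := simultaneous_diagonalization (posdefmx1 R n) Hs.
rewrite mulmx1 in UU.
have Uu : U \in unitmx by have [] := mulmx1_unit UU.
have Uinv : U^T = invmx U by rewrite -[LHS]mulmx1 -(mulmxV Uu) mulmxA UU mul1mx.
have form (c : 'cV[R]_n) :
    ((U *m c)^T *m H *m (U *m c)) 0 0 = \sum_i d 0 i * c i 0 ^+ 2.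
  rewrite trmx_mul !mulmxA -(mulmxA _ U^T) -(mulmxA _ _ U) UH mul_mx_diag mxE.
  by apply: eq_bigr => i _; rewrite !mxE; ring.
exists d; split.
- have <- : char_poly (diag_mx d) = char_poly H.
    pose V := map_mx polyC U.
    have VV : V^T *m V = 1%:M by rewrite map_trmx -map_mxM UU map_mx1.
    have -> : char_poly (diag_mx d) = \det (V^T *m char_poly_mx H *m V).
      rewrite /char_poly /char_poly_mx -UH mulmxBr mulmxBl !map_mxM -map_trmx.
      by rewrite mul_mx_scalar -scalemxAl VV scalemx1.
    have dV : \det V * \det V = 1 by rewrite -{1}det_tr -det_mulmx VV det1.
    by rewrite !det_mulmx det_tr mulrAC dV mul1r.
  rewrite char_poly_trig ?diag_mx_is_trig //.
  by apply: eq_bigr => i _; rewrite mxE eqxx.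
- have dU : \det U * \det U = 1 by rewrite -{1}det_tr -det_mulmx UU det1.
  by rewrite -det_diag -UH !det_mulmx det_tr mulrAC dU mul1r.
- have [i0 di0] : exists i, 0 < d 0 i.
    apply/existsP; apply: contraLR pos; rewrite negb_exists -leNgt => /forallP d_le0.
    rewrite -[w](mulKVmx Uu) form; apply: sumr_le0 => i _.
    by rewrite mulr_le0_ge0 ?sqr_ge0 // leNgt.
  exists i0 => // i ii0; rewrite ltNge; apply/negP => di.
  pose al j := (g^T *m U) 0 j.
  (* A vector of the plane of the eigenvectors [i] and [i0] orthogonal to [g]. *)
  have [c [c0 cg csupp]] : exists c : 'cV[R]_n,
      [/\ c != 0, (g^T *m (U *m c)) 0 0 = 0
        & forall j, j != i -> j != i0 -> c j 0 = 0].
    have gU j : (g^T *m (U *m (delta_mx j 0 : 'cV[R]_n))) 0 0 = al j.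
      by rewrite mulmxA -colE mxE.
    have [a0|a0] := eqVneq (al i) 0.
      exists (delta_mx i 0); split; rewrite ?gU //.
        by apply/eqP => /colP /(_ i) /eqP; rewrite !mxE !eqxx oner_eq0.
      by move=> j ji _; rewrite mxE (negPf ji).
    exists (al i *: delta_mx i0 0 - al i0 *: delta_mx i 0); split.
    + apply/eqP => /colP /(_ i0) /eqP.
      by rewrite !mxE !eqxx [i0 == i]eq_sym (negPf ii0) mulr0 subr0 mulr1 (negPf a0).
    + rewrite !mulmxBr -!scalemxAr [LHS]mxE [X in X + _]mxE [X in _ + X]mxE.
      by rewrite [X in _ - X]mxE !gU mulrC subrr.
    + by move=> j ji ji0; rewrite !mxE (negPf ji) (negPf ji0) !mulr0 subr0.
  have Uc0 : U *m c != 0.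
    by apply: contra_neq c0 => Uc; rewrite -[c](mulKmx Uu) Uc mulmx0.
  have := neg _ Uc0 cg; rewrite form ltNge => /negP; apply.
  apply: sumr_ge0 => j _; have [->|ji] := eqVneq j i.
    by rewrite mulr_ge0 ?sqr_ge0.
  have [->|ji0] := eqVneq j i0; first by rewrite mulr_ge0 ?sqr_ge0 // ltW.
  by rewrite csupp // expr0n mulr0.
Qed.

Lemma lorentzian_spectrum (R : realType) (n : nat) (H : 'M[R]_n)
    (d : 'rV[R]_n) :
  char_poly H = \prod_i ('X - (d 0 i)%:P) -> \det H = \prod_i d 0 i ->
  (exists2 i0, 0 < d 0 i0 & forall i, i != i0 -> d 0 i < 0) ->
  [/\ H \in unitmx,
      exists2 s : seq R, eigenvalues_with_multiplicity H s &
        count (fun x => x < 0) s = n.-1 /\ count (fun x => 0 < x) s = 1%N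
    & 0 < (-1) ^+ n.-1 * \det H].
Proof.
move=> charH detH [i0 d0 dneg].
have det_pos : 0 < (-1) ^+ n.-1 * \det H.
  have -> : n.-1 = #|predC1 i0| by rewrite cardC1 card_ord.
  rewrite detH (bigD1 i0) //= mulrCA -prodrN mulr_gt0 //.
  by apply: prodr_gt0 => i ii0; rewrite oppr_gt0 dneg.
split=> //.
  by rewrite unitmxE unitfE; apply: contraTneq det_pos => ->; rewrite mulr0 ltxx.
exists [seq d 0 i | i <- enum 'I_n].
  by rewrite /eigenvalues_with_multiplicity charH big_map big_enum.
have countE (P : pred R) :
    count P [seq d 0 i | i <- enum 'I_n] = #|[pred i | P (d 0 i)]|.
  rewrite count_map -size_filter cardE [in RHS]/enum_mem enumT.
  by congr size; exact: eq_filter.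
rewrite !countE; split.
  rewrite -[in RHS](card_ord n) -(cardC1 i0); apply: eq_card => i; rewrite !inE.
  by have [->|/dneg ->//] := eqVneq i i0; rewrite ltNge (ltW d0).
rewrite -[in RHS](card1 i0); apply: eq_card => i; rewrite !inE.
by have [->|/dneg di] := eqVneq i i0; rewrite ?d0 // ltNge (ltW di).
Qed.

(** * The theorem *)

Lemma edge_labelling_endpoints (V : finType) (G : sgraph V) (n : nat)
    (lab : 'I_n -> {set V}) :
  edge_labelling G lab ->
  exists src tgt : 'I_n -> V,
    (forall k, lab k = [set src k; tgt k]) /\ forall k, src k != tgt k.
Proof.
move=> [_ im_lab].
have ends k : exists2 p : V * V, lab k = [set p.1; p.2] & p.1 != p.2.
  have : lab k \in edges G by rewrite -im_lab imset_f ?in_setT.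
  move=> /imsetP [p]; rewrite inE => Gp ->; exists p => //.
  by apply: contraTneq Gp => ->; rewrite adj_irr.
have /fin_all_exists2 [p pE pN] := ends.
by exists (fun k => (p k).1), (fun k => (p k).2).
Qed.

Lemma connected_all_edges (V : finType) (G : sgraph V) (n : nat)
    (lab : 'I_n -> {set V}) :
  connected G -> edge_labelling G lab ->
  connected (spanning_rel lab [set: 'I_n]).
Proof.
move=> Gc [_ im_lab] x y; apply: connect_sub (Gc x y) => u w Guw.
apply: connect1; rewrite /spanning_rel /= im_lab.
by apply/imsetP; exists (u, w); rewrite ?inE.
Qed.

Lemma root_enumeration (V : finType) (r : nat) :
  #|V| = r.+1 ->
  exists (root : V) (vtx : 'I_r -> V),
    [/\ injective vtx, forall i, vtx i != root
      & forall x, x != root -> exists i, vtx i = x].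
Proof.
move=> cV; pose e (i : 'I_r.+1) : V := enum_val (cast_ord (esym cV) i).
have eI : injective e by move=> i j /enum_val_inj /cast_ord_inj.
exists (e ord0), (fun i => e (lift ord0 i)); split.
- by move=> i j /eI /lift_inj.
- by move=> i; rewrite (inj_eq eI) eq_sym neq_lift.
- move=> x; have -> : x = e (cast_ord cV (enum_rank x)).
    by rewrite /e cast_ordK enum_rankK.
  by rewrite (inj_eq eI) eq_sym => /unlift_some [i -> _]; exists i.
Qed.

Theorem theorem1p1 (R : realType) (V : finType) (G : sgraph V) (r n : nat)
    (lab : 'I_n -> {set V})
    (r_ge2 : (2 <= r)%N)
    (card_V : #|V| = r.+1)
    (G_connected : connected G)
    (lab_edges : edge_labelling G lab) :
  strictly_log_concave_on (@positive_orthant R n) (kirchhoff R lab) /\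
  (forall a : 'I_n -> R, positive_orthant a ->
    [/\ mx_at (hessian (kirchhoff R lab)) a \in unitmx,
        exists2 s : seq R,
          eigenvalues_with_multiplicity
            (mx_at (hessian (kirchhoff R lab)) a) s
          & count (fun x => x < 0) s = n.-1 /\ count (fun x => 0 < x) s = 1%N
      & 0 < (-1) ^+ n.-1 * (\det (hessian (kirchhoff R lab))).@[a]]).
Proof.
have [src [tgt [labE src_tgt]]] := edge_labelling_endpoints lab_edges.
have [root [vtx [vtxI vtx_root vtx_onto]]] := root_enumeration card_V.
have lab_inj := lab_edges.1.
have all_conn := connected_all_edges G_connected lab_edges.
set F := kirchhoff R lab; pose L := laplacian src tgt vtx (R := R).
have FE a : F.@[a] = \det (L a).
  by rewrite /F (weighted_matrix_tree lab_inj labE src_tgt vtxI vtx_root vtx_onto).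
have Lpos a : positive_orthant a -> posdefmx (L a).
  exact: (laplacian_posdef labE src_tgt vtxI vtx_root all_conn).
have gap (a : 'I_n -> R) (v : 'cV[R]_n) : positive_orthant a -> v != 0 ->
    let p := restrict_line a (fun i => v i 0) F in
    0 < p^`().[0] ^+ 2 - p.[0] * p^`()^`().[0].
  move=> a_gt0 v0; set p := restrict_line _ _ _; have /cV0Pn [k vk] := v0.
  apply: (det_pencil_log_gap (Lpos a a_gt0) (laplacian_sym src tgt vtx _)).
    exact: (laplacian_neq0 lab_inj labE src_tgt vtxI vtx_root vtx_onto vk).
  by move=> t; rewrite /p horner_restrict_line FE /L laplacianD.
split=> [a a_gt0|a a_gt0].
  split=> [|v v0]; last by rewrite log_concavity_form; apply: gap.
  by rewrite mx_at_log_concavity linearD linearZ /= hessian_at_sym trmx_mul trmxK.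
rewrite -det_map_mx -/(mx_at _ _).
have hyperbolic (v : 'cV[R]_n) : v != 0 ->
    ((mx_at (gradient F) a)^T *m v) 0 0 = 0 ->
    (v^T *m mx_at (hessian F) a *m v) 0 0 < 0.
  move=> v0 gv; have := gap a v a_gt0 v0.
  rewrite /= deriv1_restrict_line gv.
  rewrite horner0_restrict_line deriv2_restrict_line FE.
  by rewrite expr0n sub0r oppr_gt0 pmulr_rlt0 // posdefmx_det_gt0 //; apply: Lpos.
have euler : 0 < ((\col_i a i)^T *m mx_at (hessian F) a *m (\col_i a i)) 0 0.
  rewrite -deriv2_restrict_line.
  (* F is homogeneous of degree r because the Laplacian is linear. *)
  have -> : restrict_line a (fun i => (\col_i a i) i 0) F =
      \det (L a) *: (1 + 'X) ^+ r.
    apply: horner_ext => t; rewrite horner_restrict_line FE.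
    rewrite hornerZ horner_exp hornerD hornerX hornerC.
    rewrite mulrC -detZ; congr (\det _); rewrite /L scalerDl scale1r -laplacianD.
    by congr laplacian; apply/funext => k; rewrite mxE.
  have -> : ((\det (L a) *: (1 + 'X) ^+ r)^`()^`()).[0] =
      \det (L a) *+ (r * r.-1).
    have d1 : (1 + 'X : {poly R})^`() = 1 by rewrite derivD derivX derivC add0r.
    rewrite !derivZ deriv_exp d1 mul1r derivMn deriv_exp d1 mul1r.
    rewrite hornerZ !hornerMn horner_exp hornerD hornerX hornerC addr0 expr1n.
    by rewrite -mulrnA mulr_natr mulnC.
  rewrite pmulrn_lgt0; first exact/posdefmx_det_gt0/Lpos.
  by rewrite muln_gt0; case: (r) r_ge2 => [|[]].
have [d [charH detH dsign]] :=
  lorentzian_signature (hessian_at_sym F a) hyperbolic euler.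
exact: lorentzian_spectrum charH detH dsign.
Qed.
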